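(* Let $k\ge1$ and let $G$ and $G'$ be graphs without isolated vertices. Suppose that $M_k(G)$ is a connected matroid, that $S(x,G)$ is a non-separating cocircuit of $M_k(G)$ for every vertex $x$ of $G$, and that $M_k(G)=M_k(G')$. Then $\mathcal{S}(G)=\mathcal{S}(G')$, i.e. $G$ and $G'$ are strongly isomorphic.
   Context: Graphs are finite and may have loops and parallel edges. For $X\subseteq E(G)$, $G\langle X\rangle$ is the subgraph of $G$ with edge set $X$ whose vertices are the end-vertices of edges in $X$. $\Delta G=|E(G)|-|V(G)|$. $\mathcal{G}_{\bowtie}$ is the set of graphs having no isolated vertices, no leaves (vertices of degree 1, a loop contributing 2 to the degree), and no cycle components (components that are cycles; a vertex with a single loop is a cycle, and two parallel edges form a cycle). For $k\ge1$ the $k$-circular matroid $M_k(G)$ is the matroid on $E(G)$ whose circuits are the sets $C\subseteq E(G)$ with $\Delta G\langle C\rangle=k$ and $G\langle C\rangle\in\mathcal{G}_{\bowtie}$ (these are known to be the circuits of a matroid). Equality $M_k(G)=M_k(G')$ means equality of ground sets $E(G)=E(G')$ and of the families of circuits. A matroid is connected if its ground set is nonempty, it has no loops and no coloops, and every two elements belong to a common circuit. A cocircuit $K$ of a connected matroid $M$ is non-separating if the deletion $M\setminus K$ is a connected matroid. $S(x,G)$ is the set of edges of $G$ incident to $x$ (loops included), and $\mathcal{S}(G)=\{S(x,G):x\in V(G)\}$. Graphs $G=(V,E,\phi)$ and $G'=(V',E,\phi')$ with the same edge set are strongly isomorphic if there is a bijection $\nu:V\to V'$ such that for each edge $e$: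 $\phi(e)=\{x,y\}\Leftrightarrow\phi'(e)=\{\nu(x),\nu(y)\}$, where $\phi(e)$ is the set of end-vertices of $e$. *)

(* Defs.v *)
From HB Require Import structures.
From mathcomp Require Import all_boot all_order all_algebra.

Set Implicit Arguments.
Unset Strict Implicit.
Unset Printing Implicit Defensive.

Import GRing.Theory.

(* Finite graphs with loops and parallel edges. The vertices and the edges are
   finite subsets of ambient types, so that subgraphs, and different graphs on
   the same edge set, can be compared. [ends G e] is the set of end-vertices
   of e, a singleton when e is a loop; outside [eset G] its value is
   irrelevant. *)
Record graph (V E : finType) := Graph {
  vset : {set V};
  eset : {set E};
  ends : E -> {set V};
  graphP : {in eset, forall e, ends e \subset vset /\ 0 < #|ends e| <= 2}
}.

Section GraphDefs.
Variables V E : finType.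
Implicit Types (G : graph V E) (X : {set E}) (W : {set V}).

Definition star G (x : V) : {set E} := [set e in eset G | x \in ends G e].
Definition loops_at G (x : V) : {set E} :=
  [set e in eset G | ends G e == [set x]].
Definition degree G (x : V) : nat := #|star G x| + #|loops_at G x|.

Definition stars G : {set {set E}} := [set star G x | x in vset G].

Definition no_isolated G : bool := [forall x in vset G, star G x != set0].
Definition no_leaf G : bool := [forall x in vset G, degree G x != 1].

Definition Delta G : int := (#|eset G|%:Z - #|vset G|%:Z)%R.

Fact edge_subgraphP G X :
  {in X :&: eset G, forall e,
    ends G e \subset \bigcup_(f in X :&: eset G) ends G f /\
    0 < #|ends G e| <= 2}.
Proof.
move=> e eX; split; first exact: (bigcup_sup e).
by move: eX; rewrite inE => /andP[_ /graphP[]].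
Qed.

(* The graph G<X>. *)
Definition edge_subgraph G X : graph V E := Graph (@edge_subgraphP G X).

Fact induced_subgraphP G W :
  {in [set e in eset G | ends G e \subset W], forall e,
    ends G e \subset vset G :&: W /\ 0 < #|ends G e| <= 2}.
Proof.
by move=> e; rewrite inE => /andP[/graphP[sV c] sW]; rewrite subsetI sV sW.
Qed.

Definition induced_subgraph G W : graph V E := Graph (@induced_subgraphP G W).

Definition adj G : rel V :=
  [rel x y | [exists e in eset G, (x \in ends G e) && (y \in ends G e)]].

Definition connected_graph G : bool :=
  (vset G != set0) && [forall x in vset G, forall y in vset G,
                         connect (adj G) x y].

(* The connected component of G containing the vertex x. *)
Definition component G (x : V) : graph V E :=
  induced_subgraph G [set y | connect (adj G) x y].

(* With this notion of degree, a single loop and a pair of parallel edges are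
   cycles. *)
Definition is_cycle G : bool :=
  connected_graph G && [forall x in vset G, degree G x == 2].

Definition no_cycle_component G : bool :=
  [forall x in vset G, ~~ is_cycle (component G x)].

(* Membership in the class of graphs denoted G with a bow-tie subscript. *)
Definition bowtie_graph G : bool :=
  [&& no_isolated G, no_leaf G & no_cycle_component G].

End GraphDefs.

Definition strongly_isomorphic (V V' E : finType)
    (G : graph V E) (G' : graph V' E) : Prop :=
  eset G = eset G' /\
  exists2 nu : {x : V | x \in vset G} -> {x : V' | x \in vset G'},
    bijective nu &
    {in eset G, forall e x y,
      ends G e = [set val x; val y] <->
      ends G' e = [set val (nu x); val (nu y)]}.

(* Matroids on a finite ground set, given by their circuits. *)
Record matroid (E : finType) := Matroid {
  ground : {set E};
  circuits : {set {set E}};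
  circuits_ground : {in circuits, forall C : {set E}, C \subset ground};
  circuits_neq0 : set0 \notin circuits;
  circuits_antichain :
    {in circuits &, forall C1 C2 : {set E}, C1 \subset C2 -> C1 = C2};
  circuits_elim :
    {in circuits &, forall C1 C2 : {set E}, C1 != C2 ->
      {in C1 :&: C2, forall e,
        exists2 C3, C3 \in circuits & C3 \subset (C1 :|: C2) :\ e}}
}.

Definition same_matroid (E : finType) (M N : matroid E) : Prop :=
  ground M = ground N /\ circuits M = circuits N.

Section MatroidDefs.
Variables (E : finType) (M : matroid E).
Implicit Types (B I K D : {set E}) (e : E).

Definition indep I : bool :=
  (I \subset ground M) && [forall C in circuits M, ~~ (C \subset I)].
Definition basis B : bool := maxset indep B.

(* Independence in the dual matroid, whose bases are the complements of the
   bases of M. *)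
Definition coindep I : bool :=
  [exists B, basis B && (I \subset ground M :\: B)].

(* Circuits of the dual matroid. *)
Definition cocircuit K : bool :=
  minset [pred D : {set E} | (D \subset ground M) && ~~ coindep D] K.

Definition loop e : bool := [set e] \in circuits M.
Definition coloop e : bool := cocircuit [set e].

Definition mconnected : bool :=
  [&& ground M != set0,
      [forall e in ground M, ~~ loop e && ~~ coloop e] &
      [forall e in ground M, forall f in ground M, (e != f) ==>
         [exists C in circuits M, (e \in C) && (f \in C)]]].

Definition del_ground K : {set E} := ground M :\: K.
Definition del_circuits K : {set {set E}} :=
  [set C in circuits M | C \subset del_ground K].

Fact del_circuits_ground K :
  {in del_circuits K, forall C : {set E}, C \subset del_ground K}.
Proof. by move=> C; rewrite inE => /andP[]. Qed.

Fact del_circuits_neq0 K : set0 \notin del_circuits K.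
Proof. by rewrite inE negb_and circuits_neq0. Qed.

Fact del_circuits_antichain K :
  {in del_circuits K &, forall C1 C2 : {set E}, C1 \subset C2 -> C1 = C2}.
Proof.
move=> C1 C2 /setIdP[c1 _] /setIdP[c2 _].
exact: circuits_antichain c1 c2.
Qed.

Fact del_circuits_elim K :
  {in del_circuits K &, forall C1 C2 : {set E}, C1 != C2 ->
    {in C1 :&: C2, forall e,
      exists2 C3, C3 \in del_circuits K & C3 \subset (C1 :|: C2) :\ e}}.
Proof.
move=> C1 C2 /setIdP[c1 s1] /setIdP[c2 s2] n12 e e12.
have [C3 c3 s3] := circuits_elim c1 c2 n12 e12.
exists C3 => //; rewrite inE c3 (subset_trans s3) //.
by apply: subset_trans (subsetDl _ _) _; rewrite subUset s1.
Qed.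

Definition deletion K : matroid E :=
  Matroid (@del_circuits_ground K) (@del_circuits_neq0 K)
          (@del_circuits_antichain K) (@del_circuits_elim K).

End MatroidDefs.

Definition nonseparating_cocircuit (E : finType) (M : matroid E)
    (K : {set E}) : bool :=
  cocircuit M K && mconnected (deletion M K).

Definition circular_circuits (V E : finType) (k : nat) (G : graph V E) :
    {set {set E}} :=
  [set C : {set E} | [&& C \subset eset G,
                         Delta (edge_subgraph G C) == k%:Z%R &
                         bowtie_graph (edge_subgraph G C)]].

Section CircularMatroid.
Variables (V E : finType).
Implicit Types (G : graph V E) (X Y C : {set E}) (W : {set V}) (k : nat).

(* The number of ends of e that lie in W, a loop having two ends. *)
Definition ends_in G W e :=
  \sum_(x in W) ((x \in ends G e) + (ends G e == [set x])).

Lemma sum_degree G W :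
  \sum_(x in W) degree G x = \sum_(e in eset G) ends_in G W e.
Proof.
rewrite exchange_big /=; apply: eq_bigr => x _; rewrite /degree big_split /=.
congr (_ + _).
  by rewrite -sum1dep_card big_mkcondr; apply: eq_bigr => e _; case: ifP.
by rewrite -sum1dep_card big_mkcondr; apply: eq_bigr => e _; case: ifP.
Qed.

Lemma ends_inE G W e : e \in eset G ->
  ends_in G W e =
    if #|ends G e| == 1 then (#|ends G e :&: W|).*2 else #|ends G e :&: W|.
Proof.
move=> /graphP[_ /andP[e_gt0 _]]; rewrite /ends_in big_split /=.
have -> : \sum_(x in W) (x \in ends G e : nat) = #|ends G e :&: W|.
  rewrite setIC -sum1_card big_mkcond [RHS]big_mkcond /=.
  by apply: eq_bigr => x _; rewrite inE; case: (x \in W); case: (_ \in _).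
case: ifPn => [/cards1P[y ey]|n1]; last first.
  rewrite big1 ?addn0 // => x _; case: eqP => // ex.
  by rewrite ex cards1 in n1.
rewrite -addnn ey; congr (_ + _).
rewrite setIC -sum1_card big_mkcond [RHS]big_mkcond /=.
apply: eq_bigr => x _; rewrite !inE (inj_eq set1_inj) eq_sym.
by case: (x \in W); case: (_ == _).
Qed.

Lemma ends_in_le2 G W e : e \in eset G -> ends_in G W e <= 2.
Proof.
move=> eG; rewrite ends_inE //; have [_ /andP[_ e2]] := graphP eG.
have le := subset_leq_card (subsetIl (ends G e) W).
case: ifP => [/eqP e1|_]; last exact: leq_trans le e2.
by rewrite -[2]/(1.*2) leq_double -e1.
Qed.

Lemma ends_in_sub G W e :
  e \in eset G -> 2 <= ends_in G W e -> ends G e \subset W.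
Proof.
move=> eG; rewrite ends_inE //; have [_ /andP[_ e2]] := graphP eG => h.
apply/setIidPl/eqP; rewrite eqEcard subsetIl /=.
move: h; case: ifP => [/eqP ->|_ h]; last exact: leq_trans e2 h.
by rewrite -[2]/(1.*2) leq_double.
Qed.

Lemma sub_ends_in G W e :
  e \in eset G -> ends G e \subset W -> ends_in G W e = 2.
Proof.
move=> eG /setIidPl eW; rewrite ends_inE // eW.
have [_] := graphP eG; case: ifP => [/eqP -> //|].
by case: #|_| => [|[|[]]].
Qed.

Lemma ends_in_eq0 G W e :
  e \in eset G -> ends G e :&: W = set0 -> ends_in G W e = 0.
Proof. by move=> eG eW; rewrite ends_inE // eW cards0 if_same. Qed.

Definition cover_of G X := \bigcup_(e in X) ends G e.

Lemma vset_edge_subgraph G X :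
  X \subset eset G -> vset (edge_subgraph G X) = cover_of G X.
Proof. by move=> /setIidPl /= ->. Qed.

Lemma eset_edge_subgraph G X :
  X \subset eset G -> eset (edge_subgraph G X) = X.
Proof. by move=> /setIidPl /= ->. Qed.

Lemma adj_ends G e x y :
  e \in eset G -> x \in ends G e -> y \in ends G e -> adj G x y.
Proof.
by move=> eG xe ye; apply/existsP; exists e; rewrite eG xe ye.
Qed.

Lemma adj_sym G : symmetric (adj G).
Proof.
by move=> x y; apply: eq_existsb => e; rewrite [(x \in _) && _]andbC.
Qed.

Lemma component_closed G x e a : e \in eset G -> a \in ends G e ->
  connect (adj G) x a -> ends G e \subset [set y | connect (adj G) x y].
Proof.
move=> eG ae xa; apply/subsetP=> b be; rewrite inE.
exact: connect_trans xa (connect1 (adj_ends eG ae be)).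
Qed.

Lemma adj_component G x y :
  connect (adj G) x y -> connect (adj (component G x)) x y.
Proof.
move=> /connectP[p]; elim/last_ind: p y => [|p z IHp] y; first by move=> _ ->.
rewrite rcons_path last_rcons => /andP[xp az] ->.
apply: connect_trans (IHp _ xp erefl) (connect1 _).
have xa : connect (adj G) x (last x p) by apply/connectP; exists p.
case/existsP: az => e /and3P[eG ae ze].
apply/existsP; exists e; rewrite ae ze !andbT inE eG.
exact: component_closed ae xa.
Qed.

Lemma component_connected G x :
  x \in vset G -> connected_graph (component G x).
Proof.
move=> xG; apply/andP; split.
  by apply/set0Pn; exists x; rewrite !inE xG connect0.
have h y : y \in vset (component G x) -> connect (adj (component G x)) x y.
  by rewrite !inE => /andP[_]; apply: adj_component.
apply/forall_inP => y /h; rewrite (sym_connect_sym (@adj_sym _)) => yx.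
by apply/forall_inP => z /h; apply: connect_trans.
Qed.

Lemma degree_component G x y : connect (adj G) x y ->
  degree (component G x) y = degree G y.
Proof.
move=> xy; congr (_ + _); apply: eq_card => e; rewrite !inE.
  case eG: (e \in _) => //=; case ye: (y \in _); last by rewrite andbF.
  by rewrite (component_closed eG ye xy).
case eG: (e \in _) => //=; case: eqP => ye; last by rewrite andbF.
by rewrite (component_closed eG _ xy) // ye set11.
Qed.

Lemma cover_ofS G X Y : X \subset Y -> cover_of G X \subset cover_of G Y.
Proof.
by move=> /subsetP sXY; apply/bigcupsP => e /sXY; apply: bigcup_sup.
Qed.

Lemma cover_ofU G X Y :
  cover_of G (X :|: Y) = cover_of G X :|: cover_of G Y.
Proof. exact: bigcup_setU. Qed.

Definition dep k G X := #|cover_of G X| + k <= #|X|.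

Lemma circuit_card k G C : C \in circular_circuits k G ->
  C \subset eset G /\ #|C| = #|cover_of G C| + k.
Proof.
rewrite inE => /and3P[sC D _]; split=> //; move: D.
rewrite /Delta vset_edge_subgraph // eset_edge_subgraph //.
by rewrite GRing.subr_eq addnC => /eqP[].
Qed.

Lemma circuit_proper k G C Y : C \in circular_circuits k G ->
  Y \proper C -> ~~ dep k G Y.
Proof.
move=> cC /properP[sYC [e0 e0C e0Y]]; have [sC cardC] := circuit_card cC.
move: cC; rewrite inE => /and3P[_ _ /and3P[iH lH cH]].
set H := edge_subgraph G C in iH lH cH.
have vH : vset H = cover_of G C by exact: vset_edge_subgraph.
have eH : eset H = C by exact: eset_edge_subgraph.
apply/negP; rewrite /dep => depY.
pose W := cover_of G C :\: cover_of G Y.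
have WC w : w \in W -> w \in vset H by rewrite vH inE => /andP[].
have deg2 w : w \in W -> 2 <= degree H w.
  move=> /WC wH; have := forall_inP lH _ wH; have := forall_inP iH _ wH.
  by rewrite -card_gt0 /degree; case: #|_| => [|[|n]] //; case: #|_|.
have cW : #|W| = #|cover_of G C| - #|cover_of G Y|.
  by rewrite cardsD (setIidPr (cover_ofS _ sYC)).
have cZ : #|C :\: Y| = #|C| - #|Y| by rewrite cardsD (setIidPr sYC).
have leYC := subset_leq_card (cover_ofS G sYC).
have leYC' := subset_leq_card sYC.
have leZW : #|C :\: Y| <= #|W|.
  rewrite cZ cW cardC leq_subLR (leq_trans _ (leq_add depY (leqnn _))) //.
  by rewrite addnAC subnKC.
have sumE : \sum_(x in W) degree H x = \sum_(e in C :\: Y) ends_in H W e.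
  rewrite sum_degree eH (big_setID Y) /= big1 ?add0n // => e.
  rewrite inE => /andP[eC eY]; apply: ends_in_eq0; first by rewrite eH.
  apply/setP=> x; rewrite !inE; apply/negbTE/negP => /and3P[xe /negP xY _].
  by apply: xY; apply/bigcupP; exists e.
have lo : #|W| * 2 <= \sum_(x in W) degree H x.
  by rewrite -sum_nat_const; apply: leq_sum.
have degW w : w \in W -> degree H w = 2.
  move=> wW; apply/eqP; rewrite eqn_leq deg2 // andbT leqNgt.
  apply/negP => big.
  have : #|W| * 2 < \sum_(x in W) degree H x.
    rewrite -sum_nat_const (bigD1 w) //= [X in _ < X](bigD1 w) //= -addSn.
    by rewrite leq_add // leq_sum // => x /andP[/deg2].
  rewrite sumE ltnNge (leq_trans _ (_ : #|C :\: Y| * 2 <= _)) ?leq_mul2r //.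
  rewrite -sum_nat_const; apply: leq_sum => e; rewrite inE => /andP[_ eC].
  by apply: ends_in_le2; rewrite eH.
have sZ e : e \in C :\: Y -> ends H e \subset W.
  move=> eZ; apply: ends_in_sub; first by move: eZ; rewrite eH inE => /andP[].
  rewrite leqNgt; apply/negP => small; move: lo; rewrite sumE leqNgt.
  apply/negP/negPn; apply: (leq_trans _ (_ : #|C :\: Y| * 2 <= _)).
    rewrite -sum_nat_const (bigD1 e) //= [X in _ < X](bigD1 e) //= -addSn.
    rewrite leq_add // leq_sum // => f /andP[]; rewrite inE => /andP[_ fC] _.
    by apply: ends_in_le2; rewrite eH.
  by rewrite leq_mul2r.
have /set0Pn[w wW] : W != set0.
  by rewrite -card_gt0 (leq_trans _ leZW) // card_gt0; apply/set0Pn; exists e0;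
     rewrite inE e0Y.
have conW y : connect (adj H) w y -> y \in W.
  move=> /connectP[p]; elim/last_ind: p y => [|p z IHp] y; first by move=> _ ->.
  rewrite rcons_path last_rcons => /andP[xp az] ->.
  have aW := IHp _ xp erefl.
  case/existsP: az => e /and3P[]; rewrite eH => eC ae ze.
  apply: (subsetP (sZ e _)) => //; rewrite inE eC andbT; apply/negP => eY.
  by move: aW; rewrite inE => /andP[/negP[]]; apply/bigcupP; exists e.
have /negP[] := forall_inP cH _ (WC _ wW).
apply/andP; split; first exact: component_connected (WC _ wW).
apply/forall_inP => y; rewrite !inE => /andP[_ wy].
by rewrite degree_component // degW // conW.
Qed.

Lemma dep_circuit k G X : 0 < k -> X \subset eset G -> dep k G X ->
  exists2 C, C \in circular_circuits k G & C \subset X.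
Proof.
move=> k_gt0 sX depX.
have [C minC sCX] := @minset_exists _ (dep k G) _ depX; exists C => //.
have [depC mC] := minsetP minC.
have sC := subset_trans sCX sX.
have ndep Y : Y \proper C -> dep k G Y -> False.
  by move=> pY dY; have:= pY; rewrite (mC _ dY (proper_sub pY)) properxx.
have vH : vset (edge_subgraph G C) = cover_of G C by exact: vset_edge_subgraph.
have eH : eset (edge_subgraph G C) = C by exact: eset_edge_subgraph.
set H := edge_subgraph G C in vH eH.
have rem (F : {set E}) (W : {set V}) : F \subset C -> F != set0 ->
    W \subset cover_of G C -> #|F| <= #|W| ->
    {in C :\: F, forall e, ends G e :&: W = set0} -> False.
  move=> sF F0 sW cF eW; apply: (ndep (C :\: F)).
    case/set0Pn: F0 => e eF; apply/properP; split; first exact: subsetDl.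
    by exists e; [apply: (subsetP sF) | rewrite inE eF].
  rewrite /dep; have : cover_of G (C :\: F) \subset cover_of G C :\: W.
    apply/bigcupsP => e eF; rewrite subsetD; apply/andP; split.
      by apply: (bigcup_sup e) => //; move: eF; rewrite inE => /andP[].
    by rewrite -setI_eq0 eW.
  move=> /subset_leq_card; rewrite !cardsD (setIidPr sF) (setIidPr sW) => le.
  have leW := subset_leq_card sW; have leF := subset_leq_card sF.
  rewrite -(leq_add2r #|F|) subnK //; apply: leq_trans _ depC.
  rewrite addnAC leq_add2r (leq_trans (leq_add le cF)) // subnK //.
rewrite inE sC; apply/and3P; split=> //.
  rewrite /Delta eH vH GRing.subr_eq GRing.addrC -PoszD eqz_nat eqn_leq.
  rewrite [X in _ && X]depC andbT leqNgt.
  apply/negP => big; have [C0|/set0Pn[e eC]] := eqVneq C set0.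
    by rewrite C0 cards0 in big.
  apply: (ndep (C :\ e)); first by rewrite properD1.
  rewrite /dep -ltnS; move: big; rewrite (cardsD1 e C) eC add1n.
  apply: leq_trans; rewrite ltnS leq_add2r subset_leq_card //.
  by apply: cover_ofS; apply: subD1set.
apply/and3P; split; apply/forall_inP => x xH.
- move: (xH); rewrite vH => /bigcupP[e eC xe].
  by apply/set0Pn; exists e; rewrite inE eH eC.
- apply/negP => /eqP d1.
  have [e eC xe] : exists2 e, e \in C & x \in ends G e.
    by move: (xH); rewrite vH => /bigcupP[e]; exists e.
  have eS : e \in star H x by rewrite inE eH eC.
  have S1 : star H x = [set e].
    apply/esym/eqP; rewrite eqEcard sub1set eS cards1.
    by rewrite -d1 /degree leq_addr.
  apply: (rem [set e] [set x]); rewrite ?sub1set ?cards1 -?vH //.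
    by apply/set0Pn; exists e; rewrite set11.
  move=> f; rewrite !inE => /andP[fe fC]; apply/setP => y; rewrite !inE.
  apply/negbTE/negP => /andP[+ /eqP yx]; rewrite yx => xf.
  have : f \in star H x by rewrite inE eH fC.
  by rewrite S1 inE (negbTE fe).
apply/negP => /andP[_ /forall_inP d2].
pose K := component H x.
have sKW : vset K \subset cover_of G C by rewrite -vH subsetIl.
have KW y : y \in vset K -> connect (adj H) x y by rewrite !inE => /andP[].
have sKC : eset K \subset C by apply/subsetP => e; rewrite inE eH => /andP[].
have cK : #|vset K| = #|eset K|.
  apply/eqP; rewrite -(eqn_pmul2r (isT : 0 < 2)) -!sum_nat_const.
  rewrite -(eq_bigr _ (fun y yK => eqP (d2 y yK))) sum_degree.
  apply/eqP/eq_bigr => e eK; apply: sub_ends_in => //.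
  by have [] := graphP eK.
have xK : x \in vset K by rewrite !inE connect0 andbT.
apply: (rem (eset K) (vset K)) => //; rewrite ?cK //.
  by rewrite -card_gt0 -cK card_gt0; apply/set0Pn; exists x.
move=> e; rewrite inE => /andP[eK eC]; apply/setP => y; rewrite in_setI in_set0.
apply/negbTE/negP => /andP[ye /KW xy]; case/negP: eK.
by rewrite inE eH eC /=; apply: (@component_closed H) ye xy; rewrite eH.
Qed.

Fact circular_circuits_ground k G :
  {in circular_circuits k G, forall C : {set E}, C \subset eset G}.
Proof. by move=> C; rewrite inE => /andP[]. Qed.

Fact circular_circuits_neq0 k G : 0 < k -> set0 \notin circular_circuits k G.
Proof.
move=> k_gt0; apply/negP => /circuit_card[_ /eqP].
by rewrite cards0 eq_sym addn_eq0 (gtn_eqF k_gt0) andbF.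
Qed.

Fact circular_circuits_antichain k G :
  {in circular_circuits k G &, forall C1 C2 : {set E},
    C1 \subset C2 -> C1 = C2}.
Proof.
move=> C1 C2 c1 c2; rewrite subEproper => /orP[/eqP //|].
by move=> /(circuit_proper c2)/negP[]; rewrite /dep; case: (circuit_card c1) => _ ->.
Qed.

Fact circular_circuits_elim k G : 0 < k ->
  {in circular_circuits k G &, forall C1 C2 : {set E}, C1 != C2 ->
    {in C1 :&: C2, forall e,
      exists2 C3, C3 \in circular_circuits k G
                & C3 \subset (C1 :|: C2) :\ e}}.
Proof.
move=> k_gt0 C1 C2 c1 c2 n12 e; rewrite inE => /andP[e1 e2].
have [s1 card1] := circuit_card c1; have [s2 card2] := circuit_card c2.
apply: dep_circuit => //.
  by apply: subset_trans (subD1set _ _) _; rewrite subUset s1.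
have pI : C1 :&: C2 \proper C1.
  rewrite properE subsetIl subsetI subxx /=; apply/negP.
  by move=> /(circular_circuits_antichain c1 c2)/eqP; rewrite (negbTE n12).
have := circuit_proper c1 pI; rewrite /dep -ltnNge => ltI.
have sI : cover_of G (C1 :&: C2) \subset cover_of G C1 :&: cover_of G C2.
  by rewrite subsetI !cover_ofS ?subsetIl ?subsetIr.
have leI := subset_leq_card sI.
have leD : #|cover_of G ((C1 :|: C2) :\ e)| <= #|cover_of G (C1 :|: C2)|.
  by apply/subset_leq_card/cover_ofS/subD1set.
apply: leq_trans (leq_add leD (leqnn k)) _.
have := cardsD1 e (C1 :|: C2); rewrite inE e1 /= add1n => cardD.
rewrite -ltnS -cardD.
have cU := cardsUI C1 C2; have := cardsUI (cover_of G C1) (cover_of G C2).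
rewrite -cover_ofU => cV.
rewrite -(ltn_add2r #|C1 :&: C2|) cU card1 card2 addnACA -cV.
rewrite -!addnA ltn_add2l addnA [X in _ < X]addnC ltn_add2l.
by rewrite (leq_trans ltI) // leq_add2r.
Qed.

Definition circular_matroid k (k_gt0 : 0 < k) G : matroid E :=
  Matroid (@circular_circuits_ground k G) (circular_circuits_neq0 G k_gt0)
          (@circular_circuits_antichain k G) (circular_circuits_elim k_gt0).

End CircularMatroid.

(* Main.v *)
(** If X is nonempty and the restriction of M_k(G) to X has no coloops, then X has
    rank |V(X)| + k - 1: among the subsets of a basis B, those that attain the
    independence bound |Y| < |V(Y)| + k are closed under union, the largest one
    contains the trace on B of every fundamental circuit, and its complement in
    B consists of coloops. Hence both graphs have the same number of vertices,
    and the complement of a non-separating cocircuit K misses exactly one vertex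
    of G' (and of G). The star of that vertex meets every basis, by the
    independence bound, so it is K by minimality. *)
Require Import Defs.
From mathcomp Require Import all_boot all_order all_algebra.
From mathcomp Require Import zify.

Set Implicit Arguments.
Unset Strict Implicit.
Unset Printing Implicit Defensive.

(** * Bases, circuits and cocircuits of a general matroid *)

Section Matroid.
Variables (E : finType) (M : matroid E).
Implicit Types (B I J K D C : {set E}) (e f : E).

Lemma indep_extend I : indep M I -> exists2 B, basis M B & I \subset B.
Proof. by move=> /maxset_exists[B]; exists B. Qed.

Lemma basis_indep B : basis M B -> indep M B.
Proof. exact: maxsetp. Qed.

Lemma basis_ground B : basis M B -> B \subset ground M.
Proof. by move=> /basis_indep/andP[]. Qed.

Lemma indep_sub I J : I \subset J -> indep M J -> indep M I.
Proof.
move=> sIJ /andP[sJ /forall_inP cJ]; apply/andP; split.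
  exact: subset_trans sJ.
by apply/forall_inP => C /cJ; apply: contra => /subset_trans; apply.
Qed.

Lemma indep0 : indep M set0.
Proof.
rewrite /indep sub0set; apply/forall_inP => C cC; rewrite subset0.
by apply: contraTneq cC => ->; apply: circuits_neq0.
Qed.

Lemma fundamental_circuit B e : basis M B -> e \in ground M -> e \notin B ->
  exists2 C, C \in circuits M & (e \in C) && (C :\ e \subset B).
Proof.
move=> bB eM eB.
have : ~~ indep M (e |: B).
  apply: contra eB => iB; rewrite -(maxsetsup bB iB) ?setU11 //.
  exact: subsetUr.
rewrite /indep subUset sub1set eM basis_ground //= negb_forall_in.
move=> /exists_inP[C cC]; rewrite negbK => sC; exists C => //.
rewrite subDset sC andbT; have /andP[_ /forall_inP/(_ C cC)] := basis_indep bB.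
apply: contraR => eC; apply/subsetP => f fC.
have := subsetP sC f fC; rewrite !inE => /predU1P[fe|//].
by rewrite -fe fC in eC.
Qed.

(** If no circuit contained [e], fundamental circuits would force [e] into every basis, making
    [[set e]] a cocircuit. *)
Lemma non_coloop_mem_circuit e : e \in ground M -> ~~ coloop M e ->
  exists2 C, C \in circuits M & e \in C.
Proof.
move=> eM ncl; apply/exists_inP; apply: contraR ncl => noC.
apply/minsetP; split.
  rewrite /= sub1set eM; apply/negP => /exists_inP[B bB].
  rewrite sub1set inE => /andP[eB _].
  by have [C cC /andP[eC _]] := fundamental_circuit bB eM eB; case/exists_inP: noC; exists C.
move=> D /andP[_ iD]; rewrite subset1 => /orP[/eqP //|/eqP D0].
case/negP: iD; have [B bB _] := indep_extend indep0.
by apply/exists_inP; exists B => //; rewrite D0 sub0set.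
Qed.

Lemma mconnected_mem_circuit e : mconnected M -> e \in ground M ->
  exists2 C, C \in circuits M & e \in C.
Proof.
move=> /and3P[_ /forall_inP nl _] eM; apply: non_coloop_mem_circuit => //.
by have /andP[] := nl e eM.
Qed.

Lemma cocircuit_basis K B : cocircuit M K -> basis M B -> ~~ [disjoint B & K].
Proof.
move=> /minsetp/andP[sK nK] bB; apply: contra nK => dBK.
by apply/exists_inP; exists B => //; rewrite subsetD sK disjoint_sym.
Qed.

Lemma cocircuit_min K D : cocircuit M K -> D \subset K ->
  (forall B, basis M B -> ~~ [disjoint B & D]) -> D = K.
Proof.
move=> cK sD hD; have /andP[sK _] := minsetp cK; apply: (minsetinf cK _ sD).
rewrite /= (subset_trans sD) //=.
apply/negP => /exists_inP[B /hD/negP nB]; rewrite subsetD => /andP[_ d].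
by apply: nB; rewrite disjoint_sym.
Qed.

(** For [e] in [K], minimality of [K] yields a basis avoiding [K :\ e]; it still meets [K], hence
    only in [e]. So deleting [K] lowers the rank by at most one. *)
Lemma cocircuit_exchange K : cocircuit M K ->
  exists2 B, basis M B & exists2 e, e \in B & B :\ e \subset ground M :\: K.
Proof.
move=> cK; have [K0|[e eK]] := set_0Vmem K.
  have [B bB _] := indep_extend indep0.
  by have := cocircuit_basis cK bB; rewrite K0 -setI_eq0 setI0 eqxx.
have [B bB dB] : exists2 B, basis M B & [disjoint B & K :\ e].
  have [/exists_inP[B bB dB]|no] :=
    boolP [exists B in basis M, [disjoint B & K :\ e]]; first by exists B.
  have KK : K :\ e = K.
    apply: cocircuit_min => //; first exact: subD1set.
    by move=> B bB; apply: contra no => d; apply/exists_inP; exists B.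
  by move: eK; rewrite -KK setD11.
exists B => //; exists e.
  have := cocircuit_basis cK bB; apply: contraR => eB.
  rewrite -setI_eq0 -subset0 -(_ : B :&: (K :\ e) = set0); last first.
    by apply/eqP; rewrite setI_eq0.
  apply/subsetP => f; rewrite !inE => /andP[fB ->]; rewrite fB andbT /=.
  by apply: contraNneq eB => <-.
apply/subsetP => f; rewrite !inE => /andP[fe fB].
rewrite (subsetP (basis_ground bB)) // andbT.
by have := disjointFr dB fB; rewrite !inE fe /= => ->.
Qed.

Lemma indep_deletion K I :
  indep (deletion M K) I = indep M I && (I \subset ground M :\: K).
Proof.
apply/andP/andP => /= [[sI /forall_inP cI]|[/andP[_ /forall_inP cI] sI]].
  split=> //; apply/andP; split; first exact: subset_trans sI (subsetDl _ _).
  apply/forall_inP => C cC; apply/negP => sC.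
  by have := cI C; rewrite inE cC sC (subset_trans sC) //= => /(_ isT).
by split=> //; apply/forall_inP => C; rewrite inE => /andP[/cI].
Qed.

End Matroid.

(** * Rank of restrictions of the k-circular matroid *)

Section Circular.
Variables (V E : finType) (k : nat) (G : graph V E).
Hypothesis k_gt0 : 0 < k.
Implicit Types (X Y B C I K : {set E}) (M : matroid E).

(* [M] is the restriction of the k-circular matroid of [G] to [X]. *)
Definition circular_restriction X M :=
  [/\ X \subset eset G, ground M = X
    & circuits M = [set C in circular_circuits k G | C \subset X]].

Lemma indep_not_dep X M I Y : circular_restriction X M ->
  indep M I -> Y \subset I -> #|Y| < #|cover_of G Y| + k.
Proof.
move=> [sX gM cM] iI sYI; rewrite ltnNge; apply/negP => depY.
have /andP[+ /forall_inP cI] := iI; rewrite gM => sI.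
have sYX := subset_trans sYI sI.
have [C cC sCY] := dep_circuit k_gt0 (subset_trans sYX sX) depY.
have /cI/negP[] : C \in circuits M by rewrite cM inE cC (subset_trans sCY).
exact: subset_trans sYI.
Qed.

Let tight Y := #|Y|.+1 == #|cover_of G Y| + k.

(** Edge counts are modular and vertex counts submodular, so the strict bound on the intersection
    leaves no slack for the union. The intersection may be empty, since [k] is positive. *)
Lemma tightU X M I Y1 Y2 : circular_restriction X M -> indep M I ->
  Y1 \subset I -> Y2 \subset I -> tight Y1 -> tight Y2 -> tight (Y1 :|: Y2).
Proof.
rewrite /tight => rM iI s1 s2 /eqP t1 /eqP t2.
have sU : Y1 :|: Y2 \subset I by rewrite subUset s1.
have sI : Y1 :&: Y2 \subset I by apply: subset_trans (subsetIl _ _) s1.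
have hU := indep_not_dep rM iI sU; have hI := indep_not_dep rM iI sI.
have := cardsUI Y1 Y2; have := cardsUI (cover_of G Y1) (cover_of G Y2).
rewrite -cover_ofU => cV cE.
have sV : cover_of G (Y1 :&: Y2) \subset cover_of G Y1 :&: cover_of G Y2.
  by rewrite subsetI !cover_ofS ?subsetIl ?subsetIr.
have := subset_leq_card sV; lia.
Qed.

(** A circuit exceeds the bound by exactly one edge, while [C :\ e] respects it; this leaves no room
    for losing a vertex. *)
Lemma circuit_tightD1 C e : C \in circular_circuits k G -> e \in C ->
  tight (C :\ e) /\ cover_of G (C :\ e) = cover_of G C.
Proof.
move=> cC eC; have [_ cardC] := circuit_card cC.
have := circuit_proper cC (properD1 eC); rewrite /dep -ltnNge => lt.
have := cardsD1 e C; rewrite eC => cD.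
have sc : cover_of G (C :\ e) \subset cover_of G C.
  exact/cover_ofS/subD1set.
have le := subset_leq_card sc.
have eqc : cover_of G (C :\ e) = cover_of G C.
  by apply/eqP; rewrite eqEcard sc /=; lia.
by split=> //; rewrite /tight eqc; apply/eqP; lia.
Qed.

Lemma card_basis X M B : circular_restriction X M -> X != set0 ->
  {in X, forall f, exists2 C, C \in circuits M & f \in C} ->
  basis M B -> #|B|.+1 = #|cover_of G X| + k.
Proof.
move=> rM /set0Pn[f0 f0X] memC bB; have iB := basis_indep bB.
have [sX gM cM] := rM.
have circ C : C \in circuits M -> C \in circular_circuits k G /\ C \subset X.
  by rewrite cM inE => /andP.
have sBX : B \subset X by rewrite -gM basis_ground.
have fund e : e \in X -> e \notin B -> exists2 Y : {set E},
    tight Y && (Y \subset B) & ends G e \subset cover_of G Y.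
  rewrite -gM => eM eB.
  have [C /circ[cC _] /andP[eC sC]] := fundamental_circuit bB eM eB.
  have [tC cov] := circuit_tightD1 cC eC.
  by exists (C :\ e); rewrite ?tC ?sC // cov; apply: bigcup_sup eC.
(* The empty set is tight only for [k = 1], so a first tight set is taken from a fundamental
   circuit, which exists because [X] is nonempty. *)
have [Y0 tY0] : exists Y0 : {set E}, tight Y0 && (Y0 \subset B).
  have [C0 C0M _] := memC f0 f0X; have [_ sC0X] := circ C0 C0M.
  have /subsetPn[e eC0 eB] : ~~ (C0 \subset B).
    by have /andP[_ /forall_inP] := iB; apply.
  by have [Y] := fund e (subsetP sC0X e eC0) eB; exists Y.
have [T maxT _] :=
  @maxset_exists _ [pred Y : {set E} | tight Y && (Y \subset B)] Y0 tY0.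
have /andP[tT sTB] := maxsetp maxT.
have supT Y : tight Y -> Y \subset B -> Y \subset T.
  move=> tY sY; rewrite -(maxsetsup (B := T :|: Y) maxT) ?subsetUl ?subsetUr //=.
  by rewrite (tightU rM iB) //= subUset sTB.
have endsT e : e \in X -> e \notin B -> ends G e \subset cover_of G T.
  move=> eX eB; have [Y /andP[tY sY] /subset_trans] := fund e eX eB.
  by apply; apply/cover_ofS/supT.
suff BT : B = T.
  have -> : cover_of G X = cover_of G T.
    apply/eqP; rewrite eqEsubset [X in _ && X]cover_ofS -?BT // andbT.
    apply/bigcupsP => e eX; have [eB|/(endsT e eX)] := boolP (e \in B).
      exact: bigcup_sup eB.
    by rewrite -BT.
  by rewrite BT (eqP tT).
apply/eqP; rewrite eqEsubset sTB andbT; apply/subsetP => f fB.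
have [D /circ[cD sDX] fD] := memC f (subsetP sBX f fB).
(* If [f] is outside [T], the edges [D'] of the circuit [D] lying in [B \ T]
   cover too few new vertices for [T :|: D'] to be independent. *)
apply: contraT => fT; pose D' := D :&: (B :\: T).
have fD' : f \in D' by rewrite !inE fD fT fB.
have sTD : T :|: D' \subset B.
  rewrite subUset sTB; apply: subset_trans (subsetIr _ _) (subsetDl _ _).
have := indep_not_dep rM iB sTD.
have sD' : D' \subset D by apply: subsetIl.
(* An edge of [Z] lies in [T] or outside [B]; in both cases its ends are already covered by [T]. *)
pose Z := D :\: D'.
have pZ : Z \proper D.
  apply/properP; split; first exact: subsetDl.
  by exists f; rewrite // inE fD'.
have := circuit_proper cD pZ; rewrite /dep -ltnNge.
have [_ cardD] := circuit_card cD.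
have cZ : #|D'| + #|Z| = #|D|.
  by rewrite -(cardsID D' D) (setIidPr sD').
have covZ : cover_of G Z \subset cover_of G T :&: cover_of G D.
  rewrite subsetI [X in _ && X]cover_ofS ?subsetDl // andbT; apply/bigcupsP => e.
  rewrite !inE => /andP[+ eD]; rewrite eD /= => eBT.
  have [eT|eT] := boolP (e \in T); first exact: bigcup_sup eT.
  by apply: endsT; [apply: (subsetP sDX) | rewrite eT in eBT].
have covU : cover_of G (T :|: D') \subset cover_of G T :|: cover_of G D.
  by rewrite cover_ofU setUS // cover_ofS.
have cTD : #|T :|: D'| = #|T| + #|D'|.
  rewrite cardsU (_ : T :&: D' = set0) ?cards0 ?subn0 //.
  by apply/setP => e; rewrite !inE; case: (e \in T); rewrite ?andbF.
have := cardsUI (cover_of G T) (cover_of G D).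
have := subset_leq_card covZ; have := subset_leq_card covU; move/eqP: tT.
(* The bound on [Z] makes [#|D'|] exceed the number of vertices that [D] adds to those of [T]. As
   [T] is tight, [T :|: D'] then violates its own bound. *)
by move: cardD cZ cTD; clearbody Z D'; clear -k; lia.
Qed.

Lemma card_basis_mconnected X M B : circular_restriction X M -> mconnected M ->
  basis M B -> #|B|.+1 = #|cover_of G X| + k.
Proof.
move=> rM cM; have [_ gM _] := rM.
apply: card_basis => //; first by have /and3P[] := cM; rewrite gM.
by rewrite -gM => f; apply: mconnected_mem_circuit.
Qed.

Lemma cover_of_eset : no_isolated G -> cover_of G (eset G) = vset G.
Proof.
move=> /forall_inP noI; apply/eqP; rewrite eqEsubset; apply/andP; split.
  by apply/bigcupsP => e /graphP[].
apply/subsetP => x /noI/set0Pn[e]; rewrite inE => /andP[eG xe].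
by apply/bigcupP; exists e.
Qed.

(** * Non-separating cocircuits as vertex stars *)

Variable M : matroid E.
Hypotheses (G_noI : no_isolated G) (gM : ground M = eset G).
Hypotheses (cM : circuits M = circular_circuits k G) (conM : mconnected M).

Lemma circular_restriction_full : circular_restriction (eset G) M.
Proof.
split=> //; rewrite cM; apply/setP => C; rewrite [RHS]inE.
by case cC: (C \in circular_circuits k G) => //; rewrite (circular_circuits_ground cC).
Qed.

Lemma circular_restriction_deletion K :
  circular_restriction (eset G :\: K) (deletion M K).
Proof.
by split; rewrite /= /del_circuits /del_ground ?gM ?cM ?subsetDl.
Qed.

Lemma card_basis_vset B : basis M B -> #|B|.+1 = #|vset G| + k.
Proof.
rewrite -cover_of_eset //.
exact: card_basis_mconnected circular_restriction_full conM.
Qed.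

(** The deletion has rank exactly one less: at least that by [cocircuit_exchange], and no more
    because every basis of [M] meets [K]. Both matroids are connected, so comparing the two rank
    formulas cancels [k]. *)
Lemma card_cover_nonseparating K : nonseparating_cocircuit M K ->
  #|cover_of G (eset G :\: K)|.+1 = #|vset G|.
Proof.
move=> /andP[coK conK].
have [B bB [e eB sB]] := cocircuit_exchange coK.
have iBe : indep (deletion M K) (B :\ e).
  by rewrite indep_deletion sB andbT (indep_sub _ (basis_indep bB)) ?subD1set.
have [B1 bB1 sB1] := indep_extend iBe.
have := card_basis_mconnected (circular_restriction_deletion K) conK bB1.
have /andP[iB1 sB1K] : indep M B1 && (B1 \subset ground M :\: K).
  by rewrite -indep_deletion basis_indep.
have [B2 bB2 sB12] := indep_extend iB1.
have : B1 \proper B2.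
  rewrite properEneq sB12 andbT; apply/eqP => B12.
  have /negP[] := cocircuit_basis coK bB2; rewrite -B12.
  by have := sB1K; rewrite subsetD => /andP[].
move=> /proper_card; have := card_basis_vset bB2; have := card_basis_vset bB.
by have := subset_leq_card sB1; have := cardsD1 e B; rewrite eB; clear; lia.
Qed.

Lemma star_uncovered x K :
  (x \notin cover_of G (eset G :\: K)) = (star G x \subset K).
Proof.
apply/idP/subsetP => [xK e|sK].
  rewrite inE => /andP[eG xe]; apply: contraR xK => eK.
  by apply/bigcupP; exists e; rewrite // inE eK.
apply/bigcupP => -[e /setDP[eG eK] xe].
by have := sK e; rewrite inE eG xe (negbTE eK) => /(_ isT).
Qed.

Lemma nonseparating_uncovered K : nonseparating_cocircuit M K ->
  exists x, vset G :\: cover_of G (eset G :\: K) = [set x].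
Proof.
move=> /card_cover_nonseparating cK; apply/cards1P.
rewrite cardsD (setIidPr _); first by apply/eqP; lia.
by rewrite -cover_of_eset // cover_ofS ?subsetDl.
Qed.

Lemma nonseparating_star K : nonseparating_cocircuit M K ->
  exists2 x, x \in vset G & star G x = K.
Proof.
move=> nK; have [x xP] := nonseparating_uncovered nK; exists x.
  by move/setP/(_ x): xP; rewrite set11 inE => /andP[].
have /setDP[xG] : x \in vset G :\: cover_of G (eset G :\: K) by rewrite xP set11.
rewrite star_uncovered => sK; have /andP[cK _] := nK.
apply: (cocircuit_min cK sK).
(* A basis avoiding the star would miss [x], so its size would be less than [#|vset G| - 1 + k],
   which is the rank. *)
move=> B bB; apply/negP => dB.
have := indep_not_dep circular_restriction_full (basis_indep bB) (subxx B).
have sB : B \subset eset G :\: star G x by rewrite subsetD -gM basis_ground.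
have : cover_of G B \proper vset G.
  rewrite -cover_of_eset //; apply/properP; split.
    by rewrite cover_ofS // -gM basis_ground.
  exists x; first by rewrite cover_of_eset.
  have := subxx (star G x); rewrite -star_uncovered.
  by apply: contra; apply/subsetP/cover_ofS.
by move=> /proper_card; have := card_basis_vset bB; clear; lia.
Qed.

(** Vertices with the same star are both uncovered once that star is deleted, but only one vertex
    can be. *)
Lemma nonseparating_star_inj x y : x \in vset G -> y \in vset G ->
  nonseparating_cocircuit M (star G x) -> star G x = star G y -> x = y.
Proof.
move=> xG yG /nonseparating_uncovered[z zP] xy.
have : x \in [set z] by rewrite -zP inE star_uncovered subxx.
have : y \in [set z] by rewrite -zP inE star_uncovered xy subxx.
by rewrite !inE => /eqP-> /eqP->.
Qed.

End Circular.

(** * From equal families of stars to a strong isomorphism *)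

Lemma stars_eq_strongly_isomorphic (V V' E : finType)
    (G : graph V E) (G' : graph V' E) : eset G = eset G' ->
    {in vset G &, injective (star G)} -> {in vset G' &, injective (star G')} ->
  stars G = stars G' -> strongly_isomorphic G G'.
Proof.
move=> eE injG injG' eS; split=> //.
have nuP (x : {x | x \in vset G}) :
    exists y : {y | y \in vset G'}, star G' (val y) == star G (val x).
  have /imsetP[y yG' e] : star G (val x) \in stars G'.
    by rewrite -eS; apply: imset_f; apply: valP.
  by exists (Sub y yG'); rewrite /= e.
have muP (y : {y | y \in vset G'}) :
    exists x : {x | x \in vset G}, star G (val x) == star G' (val y).
  have /imsetP[x xG e] : star G' (val y) \in stars G.
    by rewrite eS; apply: imset_f; apply: valP.
  by exists (Sub x xG); rewrite /= e.
(* Each vertex is matched with one having the same star; injectivity of the stars makes the two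
   choices mutually inverse. *)
pose nu x := xchoose (nuP x); pose mu y := xchoose (muP y).
have nuE x : star G' (val (nu x)) = star G (val x) by exact/eqP/(xchooseP (nuP x)).
have muE y : star G (val (mu y)) = star G' (val y) by exact/eqP/(xchooseP (muP y)).
have nuK : cancel nu mu.
  by move=> x; apply/val_inj/injG; rewrite ?muE ?nuE //; apply: valP.
have muK : cancel mu nu.
  by move=> y; apply/val_inj/injG'; rewrite ?muE ?nuE //; apply: valP.
exists nu; first by exists mu.
move=> e eG x y; have eG' : e \in eset G' by rewrite -eE.
have endsE z : (val (nu z) \in ends G' e) = (val z \in ends G e).
  by move/setP/(_ e): (nuE z); rewrite !inE eG eG'.
have nuI := can_inj nuK.
split=> h; apply/setP => z.
  have [zG'|zG'] := boolP (z \in vset G').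
    rewrite -[z]/(val (Sub z zG' : {y | y \in vset G'})) -(muK (Sub z zG')).
    by rewrite endsE h !inE !(inj_eq val_inj) !(inj_eq nuI).
  (* Outside the vertex set, [z] belongs to neither side. *)
  rewrite !inE -[LHS]negbK -[RHS]negbK; congr (~~ _).
  have [sG' _] := graphP eG'.
  rewrite (contra _ zG'); last by move/(subsetP sG').
  by apply/esym; apply: contra zG' => /orP[]/eqP->; apply: valP.
have [zG|zG] := boolP (z \in vset G).
  rewrite -[z]/(val (Sub z zG : {x | x \in vset G})) -endsE h.
  by rewrite !inE !(inj_eq val_inj) !(inj_eq nuI).
rewrite !inE -[LHS]negbK -[RHS]negbK; congr (~~ _).
have [sG _] := graphP eG.
rewrite (contra _ zG); last by move/(subsetP sG).
by apply/esym; apply: contra zG => /orP[]/eqP->; apply: valP.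
Qed.

(** * Transfer between the two graphs and conclusion *)

(** Connectedness unfolds to [ground] and [circuits], the fields that [same_matroid] compares; the
    proof fields of the records need not be identified. *)
Lemma mconnected_same (E : finType) (M N : matroid E) :
  same_matroid M N -> mconnected M = mconnected N.
Proof.
move=> [gE cE].
by rewrite /mconnected /loop /coloop /cocircuit /coindep /basis /indep gE cE.
Qed.

Lemma nonseparating_cocircuit_same (E : finType) (M N : matroid E) (K : {set E}) :
  same_matroid M N ->
  nonseparating_cocircuit M K = nonseparating_cocircuit N K.
Proof.
move=> [gE cE]; rewrite /nonseparating_cocircuit.
rewrite (@mconnected_same _ (deletion M K) (deletion N K)); last first.
  by split; rewrite /= /del_circuits /del_ground gE ?cE.
by rewrite /cocircuit /coindep /basis /indep gE cE.
Qed.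

Theorem theorem5p5 (k : nat) (hk : 0 < k) (E V V' : finType)
    (G : graph V E) (G' : graph V' E)
    (hG : no_isolated G) (hG' : no_isolated G')
    (hconn : mconnected (circular_matroid hk G))
    (hstar : forall x : V, x \in vset G ->
      nonseparating_cocircuit (circular_matroid hk G) (star G x))
    (heq : same_matroid (circular_matroid hk G) (circular_matroid hk G')) :
  stars G = stars G' /\ strongly_isomorphic G G'.
Proof.
have hconn' : mconnected (circular_matroid hk G') by rewrite -(mconnected_same heq).
have hstar' x : x \in vset G ->
    nonseparating_cocircuit (circular_matroid hk G') (star G x).
  by move=> /hstar; rewrite (nonseparating_cocircuit_same _ heq).
have injG : {in vset G &, injective (star G)}.
  move=> x y xG yG.
  exact: (nonseparating_star_inj (M := circular_matroid hk G) hk hG erefl erefl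
            hconn xG yG (hstar x xG)).
have sS : stars G \subset stars G'.
  apply/subsetP => _ /imsetP[x /hstar' nx ->].
  have [x' x'G' <-] := nonseparating_star (M := circular_matroid hk G')
    hk hG' erefl erefl hconn' nx.
  exact: imset_f.
(* A common basis has size [#|vset G| + k - 1] and also [#|vset G'| + k - 1]. *)
have cV : #|vset G| = #|vset G'|.
  have [B bB _] := indep_extend (indep0 (circular_matroid hk G)).
  have bB' : basis (circular_matroid hk G') B.
    by have [gE cE] := heq; move: bB; rewrite /basis /indep gE cE.
  have := card_basis_vset (M := circular_matroid hk G) hk hG erefl erefl hconn bB.
  have := card_basis_vset (M := circular_matroid hk G') hk hG' erefl erefl hconn' bB'.
  by clear; lia.
have cS : #|stars G| = #|vset G| by exact: card_in_imset.
(* The inclusion is an equality because [stars G'] has at most [#|vset G'|] members, the number that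
   [stars G] has. *)
have eS : stars G = stars G'.
  by apply/eqP; rewrite eqEcard sS cS cV leq_imset_card.
(* Here injectivity comes from counting: there are as many stars as vertices in [G']. *)
have injG' : {in vset G' &, injective (star G')}.
  by apply/imset_injP; rewrite -[X in X == _]/(#|stars G'|) -eS cS cV.
split=> //; apply: stars_eq_strongly_isomorphic => //.
by have [] := heq.
Qed.
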